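(* Let $q$ be an odd prime power and let $d\ge 3$ be odd. For every $\varepsilon>0$ there exists $c>0$ such that the following holds: if $\mathcal{P}\subseteq \mathbb{F}_q^d$ satisfies $|\mathcal{P}|\ge (1+\varepsilon)q^{(d+1)/2}$, then the number of distinct spreads determined by $\mathcal{P}$ is at least $cq$.
   Context: For $\mathbf{u},\mathbf{v}\in\mathbb{F}_q^d$, $\mathbf{u}\cdot\mathbf{v}=\sum_{i=1}^d u_iv_i$ and $\|\mathbf{x}\|=\mathbf{x}\cdot\mathbf{x}$. For points $\mathbf{a},\mathbf{b},\mathbf{c}\in\mathbb{F}_q^d$, the spread $S(\mathbf{b},\mathbf{a},\mathbf{c})$ is $$S(\mathbf{b},\mathbf{a},\mathbf{c})=1-\frac{((\mathbf{b}-\mathbf{a})\cdot(\mathbf{c}-\mathbf{a}))^2}{\|\mathbf{b}-\mathbf{a}\|\,\|\mathbf{c}-\mathbf{a}\|},$$ undefined if either factor in the denominator is $0$. The spreads determined by $\mathcal{P}$ are the values $S(\mathbf{b},\mathbf{a},\mathbf{c})$ over all $\mathbf{a},\mathbf{b},\mathbf{c}\in\mathcal{P}$ for which it is defined. The paper assumes throughout that $q$ is a large odd prime power. *)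

(* Defs.v *)
From mathcomp Require Import all_boot all_order all_algebra.

Set Implicit Arguments.
Unset Strict Implicit.
Unset Printing Implicit Defensive.

Import GRing.Theory.
Local Open Scope ring_scope.

Definition dotv (F : finFieldType) (d : nat) (u v : 'rV[F]_d) : F :=
  \sum_(i < d) u 0 i * v 0 i.

Definition normv (F : finFieldType) (d : nat) (x : 'rV[F]_d) : F := dotv x x.

Definition spread_defined (F : finFieldType) (d : nat) (b a c : 'rV[F]_d) : bool :=
  (normv (b - a) != 0) && (normv (c - a) != 0).

(* Meaningful only under [spread_defined b a c]. *)
Definition spread (F : finFieldType) (d : nat) (b a c : 'rV[F]_d) : F :=
  1 - dotv (b - a) (c - a) ^+ 2 / (normv (b - a) * normv (c - a)).

(* The points a, b, c need not be distinct; [spread_defined] already forces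
   b and c to differ from a, while b = c is allowed and yields the spread 0. *)
Definition spreads (F : finFieldType) (d : nat) (P : {set 'rV[F]_d}) : {set F} :=
  [set s | [exists a in P, exists b in P, exists c in P,
              spread_defined b a c && (s == spread b a c)]].

(* Main.v *)
(** Write q = |F| and m = (d+1)/2.  Sending F^d to F^m by an arbitrary matrix A,
    all but q^m points of P share their image with another point of P.  A fixed
    nonzero vector is killed by a proportion q^-m of the matrices, so averaging
    over A produces an apex a in P from which at least about eps q^m directions
    to other points of P are seen.  A second-moment bound for point-hyperplane
    incidences, applied to P lifted to the paraboloid, shows that only
    O(q^(-1/2)) |P|^2 pairs of P (shrunk to O(q^m) points) have an isotropic
    difference, so most of these directions are non-isotropic.  Half of them can
    be rescaled to a common norm l, giving a set E of pairwise non-proportional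
    vectors.  The same second-moment bound shows that each dot product t occurs on
    at most |E|^2/q + |E| q^(m-1) pairs of E, hence a positive proportion of all t
    occurs, and the spread 1 - t^2/l^2 determines t up to sign. *)

From HB Require Import structures.
Require Import Defs.
From mathcomp Require Import all_boot all_order all_fingroup all_algebra.
From mathcomp Require Import cyclic reals ring lra zify.

Set Implicit Arguments.
Unset Strict Implicit.
Unset Printing Implicit Defensive.

Import Order.TTheory GRing.Theory Num.Theory.
Local Open Scope ring_scope.

(** * Incidence second moment *)

(** Makes a product of finite groups a finite group, so that [card_fiber] applies to pair-valued
    maps such as x -> (x.u, x.v). *)
HB.instance Definition _ (U V : finZmodType) := GRing.Zmodule.on (U * V)%type.

(** The fibres of a surjective additive map are translates of one another: a preimage of c - y
    carries the fibre over y onto the fibre over c. *)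
Lemma card_fiber (U V : finZmodType) (f : U -> V) (c : V) :
  {morph f : x y / x + y} -> (forall y, exists x, f x = y) ->
  (#|V| * #|[set x | f x == c]|)%N = #|U|.
Proof.
move=> fD f_onto; rewrite -[RHS]sum1_card (partition_big f xpredT) //=.
rewrite -sum_nat_const; apply: eq_bigr => y _.
have [x0 fx0] := f_onto (c - y).
rewrite sum1dep_card -(card_imset _ (addIr x0)); apply: eq_card => z.
apply/idP/imsetP => [|[x]].
  rewrite inE => /eqP fz; exists (z - x0); last by rewrite subrK.
  rewrite inE -(inj_eq (addIr (f x0))) -fD subrK fz fx0.
  by rewrite addrC subrK.
by rewrite !inE => /eqP fx ->; rewrite fD fx fx0 addrC subrK.
Qed.

(** Cauchy-Schwarz against the constant 1, read off from a variance with denominators cleared. *)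
Lemma sum_sqr_le (R : realFieldType) (X : finType) (S : {set X}) (f : X -> R) :
  (\sum_(x in S) f x) ^+ 2 <= #|S|%:R * \sum_(x in S) f x ^+ 2.
Proof.
have [-> | S_neq0] := eqVneq S set0; first by rewrite !big_set0 expr2 !mulr0.
have S_gt0 : 0 < #|S|%:R :> R by rewrite ltr0n card_gt0.
set n : R := #|S|%:R.
have [s sE] : exists s, s = \sum_(x in S) f x by exists (\sum_(x in S) f x).
rewrite -sE.
have : 0 <= \sum_(x in S) (n * f x - s) ^+ 2 by apply: sumr_ge0 => x _; exact: sqr_ge0.
have -> : \sum_(x in S) (n * f x - s) ^+ 2 =
    n * (n * (\sum_(x in S) f x ^+ 2) - s ^+ 2).
  transitivity (n ^+ 2 * (\sum_(x in S) f x ^+ 2)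
      + (- 2 * n * s) * (\sum_(x in S) f x) + n * s ^+ 2); last by rewrite -sE; ring.
  have -> : n * s ^+ 2 = \sum_(x in S) s ^+ 2 by rewrite sumr_const mulr_natl.
  rewrite !mulr_sumr -!big_split /=.
  by apply: eq_bigr => x _; ring.
by rewrite pmulr_rge0 // subr_ge0.
Qed.

(** For x uniform in X the events I x y are pairwise independent of probability 1/q, so the number N
    x of incidences has mean |E|/q and variance below |E|/q when E is nonempty. Cauchy-Schwarz then
    bounds the deviation over S. *)
Lemma incidence_deviation (R : realFieldType) (X Y : finType)
    (I : X -> Y -> bool) (q n : nat) (S : {set X}) (E : {set Y}) :
  #|X| = (q ^ 2 * n)%N ->
  {in E, forall y, #|[set x | I x y]| = (q * n)%N} ->
  {in E &, forall y z, y != z -> #|[set x | I x y && I x z]| = n} ->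
  (q%:R * (\sum_(x in S) #|[set y in E | I x y]|)%:R - (#|S| * #|E|)%:R) ^+ 2
    <= (q * #|S| * #|E| * #|X|)%:R :> R.
Proof.
move=> cardX card1 card2; pose N x := #|[set y in E | I x y]|.
have NE x : N x = (\sum_(y in E) I x y)%N.
  rewrite /N -sum1_card -big_mkcondr /=.
  by apply: eq_bigl => y; rewrite inE.
have sumN : (\sum_x N x = #|E| * (q * n))%N.
  under eq_bigr do rewrite NE.
  rewrite exchange_big /= -sum_nat_const; apply: eq_bigr => y Ey.
  by rewrite -(card1 y Ey) -sum1dep_card -big_mkcond.
(* Pairs y = z contribute q n each, the others n; the term |E| n stands on the left to avoid a
   subtraction in [nat]. *)
have sumN2 : (\sum_x N x ^ 2 + #|E| * n = #|E| * (q * n) + #|E| * #|E| * n)%N.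
  have -> : (\sum_x N x ^ 2 = \sum_(y in E) \sum_(z in E) #|[set x | I x y && I x z]|)%N.
    transitivity (\sum_x \sum_(y in E) \sum_(z in E) (I x y && I x z))%N.
      apply: eq_bigr => x _; rewrite expnS expn1 {1}NE big_distrl /=.
      apply: eq_bigr => y _; rewrite NE big_distrr /=.
      by apply: eq_bigr => z _; rewrite mulnb.
    rewrite exchange_big; apply: eq_bigr => y _ /=.
    rewrite exchange_big; apply: eq_bigr => z _ /=.
    by rewrite -sum1dep_card -big_mkcond.
  rewrite -mulnA -!sum_nat_const -!big_split; apply: eq_bigr => y Ey /=.
  rewrite (bigD1 y) //= [in RHS](bigD1 y) //=.
  have -> : [set x | I x y && I x y] = [set x | I x y].
    by apply/setP => x; rewrite !inE andbb.
  rewrite card1 // -addnA [(_ + n)%N]addnC; congr (_ + (_ + _))%N.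
  by apply: eq_bigr => z /andP[Ez neq_zy]; rewrite card2 // eq_sym.
have total : \sum_x (q%:R * (N x)%:R - #|E|%:R) ^+ 2 <= (q * #|E| * #|X|)%:R :> R.
  have -> : \sum_x (q%:R * (N x)%:R - #|E|%:R) ^+ 2 =
      q%:R ^+ 2 * (\sum_x N x ^ 2)%:R - 2 * q%:R * #|E|%:R * (\sum_x N x)%:R
      + #|X|%:R * #|E|%:R ^+ 2 :> R.
    have -> : #|X|%:R * #|E|%:R ^+ 2 = \sum_(x : X) #|E|%:R ^+ 2 :> R.
      by rewrite sumr_const mulr_natl.
    rewrite !natr_sum !mulr_sumr -sumrB -big_split /=.
    by apply: eq_bigr => x _; rewrite natrX; ring.
  have {sumN2} /(congr1 (fun k => k%:R : R)) := sumN2.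
  rewrite !natrD !natrM => /(canRL (addrK _)) ->.
  rewrite sumN cardX -mulnn !natrM -subr_ge0.
  rewrite [leRHS](_ : _ = q%:R ^+ 2 * #|E|%:R * n%:R); last by ring.
  by rewrite !mulr_ge0 // exprn_ge0.
have -> : q%:R * (\sum_(x in S) N x)%:R - (#|S| * #|E|)%:R =
    \sum_(x in S) (q%:R * (N x)%:R - #|E|%:R) :> R.
  by rewrite sumrB natr_sum mulr_sumr sumr_const natrM mulr_natl.
apply: le_trans (sum_sqr_le _ _) _.
have -> : (q * #|S| * #|E| * #|X| = #|S| * (q * #|E| * #|X|))%N by ring.
rewrite natrM ler_wpM2l //; apply: le_trans total.
rewrite [leRHS](bigID [in S]) /= lerDl.
by apply: sumr_ge0 => x _; exact: sqr_ge0.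
Qed.

(** * Dot products and hyperplanes *)

Section DotProduct.
Variables (F : finFieldType) (d : nat).
Implicit Types (u v w x y z : 'rV[F]_d) (r s t : F).

Lemma dotvC u v : dotv u v = dotv v u.
Proof. by apply: eq_bigr => i _; rewrite mulrC. Qed.

Lemma dotvDl u v w : dotv (u + v) w = dotv u w + dotv v w.
Proof. by rewrite -big_split; apply: eq_bigr => i _; rewrite mxE mulrDl. Qed.

Lemma dotvZl r u w : dotv (r *: u) w = r * dotv u w.
Proof. by rewrite mulr_sumr; apply: eq_bigr => i _; rewrite mxE mulrA. Qed.

Lemma dotvDr u v w : dotv w (u + v) = dotv w u + dotv w v.
Proof. by rewrite !(dotvC w) dotvDl. Qed.

Lemma dotvZr r u w : dotv w (r *: u) = r * dotv w u.
Proof. by rewrite !(dotvC w) dotvZl. Qed.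

Lemma dotv_delta i v : dotv (delta_mx 0 i) v = v 0 i.
Proof.
rewrite /dotv (bigD1 i) //= mxE !eqxx mul1r big1 ?addr0 // => j neq_ji.
by rewrite mxE (negPf neq_ji) andbF mul0r.
Qed.

Lemma normvZ r u : normv (r *: u) = r ^+ 2 * normv u.
Proof. by rewrite /normv dotvZl dotvZr mulrA. Qed.

Lemma normvB u v : normv (u - v) = normv u - 2 * dotv u v + normv v.
Proof.
rewrite /normv -scaleN1r !(dotvDl, dotvDr, dotvZl, dotvZr) (dotvC v u).
by ring.
Qed.

Lemma row_neq0 v : v != 0 -> exists i, v 0 i != 0.
Proof.
move=> v_neq0; apply/existsP; apply: contraNT v_neq0 => /existsPn v0.
by apply/eqP/rowP => i; rewrite mxE; apply/eqP; have := v0 i; rewrite negbK.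
Qed.

Lemma card_dotv_eq v t : v != 0 ->
  #|[set x | dotv x v == t]| = (#|F| ^ d.-1)%N.
Proof.
move=> v_neq0; have [i vi] := row_neq0 v_neq0.
have F_gt0 : (0 < #|F|)%N by apply/card_gt0P; exists 0.
have d_gt0 : (0 < d)%N by apply: leq_ltn_trans (ltn_ord i).
apply/eqP; rewrite -(eqn_pmul2l F_gt0) -expnS prednK //; apply/eqP.
rewrite (@card_fiber _ _ (fun x => dotv x v)); first by rewrite card_mx mul1n.
  by move=> x y; exact: dotvDl.
move=> y; exists ((y / v 0 i) *: delta_mx 0 i).
by rewrite dotvZl dotv_delta divfK.
Qed.

(** Subtracting a multiple of u from v gives w with w_i = 0 and some w_j != 0, where u_i != 0. The
    system in the coordinates i and j is then triangular, so x -> (x.u, x.v) is onto. *)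
Lemma card_dotv_eq2 u v s t : (1 < d)%N -> u != 0 -> (forall r, v <> r *: u) ->
  #|[set x | (dotv x u == s) && (dotv x v == t)]| = (#|F| ^ d.-2)%N.
Proof.
move=> d_gt1 u_neq0 v_neq; have [i ui] := row_neq0 u_neq0.
have F_gt0 : (0 < #|F|)%N by apply/card_gt0P; exists 0.
pose w := v - (v 0 i / u 0 i) *: u.
have w_neq0 : w != 0 by rewrite subr_eq0; apply/eqP; exact: v_neq.
have [j wj] := row_neq0 w_neq0.
have wi : w 0 i = 0 by rewrite !mxE divfK // subrr.
have F2_gt0 : (0 < #|F| * #|F|)%N by rewrite muln_gt0 F_gt0.
apply/eqP; rewrite -(eqn_pmul2l F2_gt0) -[eqbRHS]mulnA -!expnS; apply/eqP.
have -> : d.-2.+2 = d by case: (d) d_gt1 => [|[]].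
have /esym -> : [set x | (dotv x u, dotv x v) == (s, t)] =
    [set x | (dotv x u == s) && (dotv x v == t)].
  by apply/setP => x; rewrite !inE.
rewrite -card_prod (@card_fiber _ _ (fun x => (dotv x u, dotv x v))).
- by rewrite card_mx mul1n.
- by move=> x y; rewrite !dotvDl.
move=> [a b]; pose c := v 0 i / u 0 i; pose e := (b - c * a) / w 0 j.
exists (e *: delta_mx 0 j + ((a - e * u 0 j) / u 0 i) *: delta_mx 0 i).
have -> : v = w + c *: u by rewrite subrK.
rewrite dotvDr dotvZr !dotvDl !dotvZl !dotv_delta wi divfK // divfK //.
by congr (_, _); ring.
Qed.

End DotProduct.

(** * Isotropic pairs and pairs with a given dot product *)

Lemma two_neq0 (F : finFieldType) : odd #|F| -> 2%:R != 0 :> F.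
Proof.
move=> F_odd; apply/eqP => two0; have /eqP := oner_neq0 F; apply.
have : (1 : F) *+ #|F| = 0.
  have := @expg_cardG F [set: F]%G 1%R (in_setT _).
  by rewrite FinRing.zmodXgE FinRing.zmod1gE cardsT.
by rewrite -(odd_double_half #|F|) F_odd mulrnDr -mul2n mulrnA two0 mul0rn addr0.
Qed.

(* The point x lifted to (x, |x|) lies on the hyperplane {(z, t) | t - 2 z.y + |y| = 0}
   exactly when |x - y| = 0, and distinct y give non-parallel hyperplanes. *)
Lemma isotropic_pairs (R : realFieldType) (F : finFieldType) (d : nat)
    (P : {set 'rV[F]_d}) : (0 < d)%N -> odd #|F| ->
  (#|F|%:R * (\sum_(x in P) #|[set y in P | normv (y - x)%R == 0%R]|)%:R
     - (#|P| * #|P|)%:R) ^+ 2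
    <= (#|P| * #|P| * #|F| ^ d.+2)%:R :> R.
Proof.
move=> d_gt0 F_odd; pose lift (x : 'rV[F]_d) := (x, normv x).
pose graph (y x : 'rV[F]_d) := (x, 2 * dotv x y - normv y).
pose I (p : 'rV[F]_d * F) y := p.2 == 2 * dotv p.1 y - normv y.
have graph_inj y : injective (graph y) by move=> x z [].
have lift_inj : injective lift by move=> x z [].
have cardX : #|{: 'rV[F]_d * F}| = (#|F| ^ 2 * #|F| ^ d.-1)%N.
  by rewrite card_prod card_mx mul1n -expnSr -expnD; congr (_ ^ _)%N; lia.
have := @incidence_deviation R _ _ I #|F| (#|F| ^ d.-1)%N (lift @: P) P cardX.
have -> : (\sum_(p in lift @: P) #|[set y in P | I p y]| =
           \sum_(x in P) #|[set y in P | normv (y - x)%R == 0%R]|)%N.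
  rewrite big_imset /=; last by move=> x y _ _; exact: lift_inj.
  apply: eq_bigr => x _; apply: eq_card => y; rewrite !inE /I /= normvB dotvC.
  by congr (_ && _); rewrite -subr_eq0; congr (_ == _); ring.
rewrite card_imset // cardX -expnD => H.
have -> : (#|P| * #|P| * #|F| ^ d.+2 = #|F| * #|P| * #|P| * #|F| ^ (2 + d.-1))%N.
  by rewrite (_ : d.+2 = (2 + d.-1).+1); [rewrite expnS; ring | lia].
apply: H => [y _ | y z _ _ neq_yz].
  have -> : [set p | I p y] = graph y @: [set: 'rV[F]_d].
    apply/setP => -[x t]; rewrite inE /I /=; apply/eqP/imsetP => [-> | [x' _ [-> ->]] //].
    by exists x; rewrite ?inE.
  by rewrite card_imset // cardsT card_mx mul1n -expnS prednK.
(* Subtracting the equations of the two hyperplanes leaves x . 2(y - z) = |y| - |z|, a genuine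
   hyperplane in x because 2 is invertible. *)
have w_neq0 : 2 *: (y - z) != 0.
  by rewrite scaler_eq0 negb_or two_neq0 // subr_eq0.
rewrite -(card_dotv_eq (normv y - normv z) w_neq0) -(card_imset _ (@graph_inj y)).
apply: eq_card => -[x t]; rewrite inE /I /=.
apply/andP/imsetP => [[/eqP -> /eqP xyz] | [x']].
  exists x => //; rewrite inE dotvZr -scaleN1r dotvDr dotvZr; apply/eqP.
  have -> : normv y = 2 * dotv x y - (2 * dotv x y - normv y) by ring.
  by rewrite xyz; ring.
rewrite inE dotvZr -scaleN1r dotvDr dotvZr => /eqP xyz [-> ->]; split=> //.
by rewrite -subr_eq0 -(subrr (normv y - normv z)) -{1}xyz; apply/eqP; ring.
Qed.

(** The second moment for the hyperplanes x.v = t with v in E: their normals are pairwise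
    non-proportional, so any two of them meet in q^(d-2) points. *)
Lemma dotv_pairs (R : realFieldType) (F : finFieldType) (d : nat)
    (E : {set 'rV[F]_d}) (t : F) : (1 < d)%N -> 0 \notin E ->
  {in E &, forall u v r, u = r *: v -> u = v} ->
  (#|F|%:R * (\sum_(u in E) #|[set v in E | dotv u v == t]|)%:R
     - (#|E| * #|E|)%:R) ^+ 2
    <= (#|E| * #|E| * #|F| ^ d.+1)%:R :> R.
Proof.
move=> d_gt1 E0 E_indep; have E_neq0 v : v \in E -> v != 0.
  by apply: contraTneq => ->.
have -> : (#|E| * #|E| * #|F| ^ d.+1 = #|F| * #|E| * #|E| * #|{: 'rV[F]_d}|)%N.
  by rewrite card_mx mul1n expnS; ring.
apply: (@incidence_deviation R _ _ _ _ (#|F| ^ d.-2)%N).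
- by rewrite card_mx mul1n -expnD; congr (_ ^ _)%N; lia.
- move=> v Ev; rewrite card_dotv_eq ?E_neq0 // -expnS; congr (_ ^ _)%N; lia.
move=> u v Eu Ev neq_uv; apply: card_dotv_eq2; rewrite ?E_neq0 // => r vE.
by move/eqP: neq_uv; apply; symmetry; exact: E_indep vE.
Qed.

(** * Directions seen from a point *)

Section Directions.
Variables (F : finFieldType) (d : nat).
Implicit Types (a b u v w : 'rV[F]_d) (P : {set 'rV[F]_d}).

(** Canonical representative of the line spanned by v: the picked coordinate is scaled to 1, and the
    choice depends only on the support of v, hence only on the line. *)
Definition dirn v : 'rV[F]_d :=
  if [pick i | v 0 i != 0] is Some i then (v 0 i)^-1 *: v else 0.

Lemma dirnP v : v != 0 -> exists2 r, r != 0 & dirn v = r *: v.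
Proof.
move=> v_neq0; rewrite /dirn; case: pickP => [i vi | v0].
  by exists (v 0 i)^-1; rewrite ?invr_eq0.
by have [i] := row_neq0 v_neq0; rewrite v0.
Qed.

Lemma dirnZ r v : r != 0 -> dirn (r *: v) = dirn v.
Proof.
move=> r_neq0; rewrite /dirn.
rewrite (eq_pick (Q := fun i => v 0 i != 0)) => [|i]; last first.
  by rewrite mxE mulf_eq0 (negPf r_neq0).
case: pickP => // i vi; rewrite mxE scalerA; congr (_ *: _).
by rewrite invfM mulrAC mulVf // mul1r.
Qed.

(** One vector for each non-isotropic line through a that meets P in a further point. *)
Definition directions P a : {set 'rV[F]_d} :=
  dirn @: [set b - a | b in P & normv (b - a) != 0].

Lemma normv0 : normv (0 : 'rV[F]_d) = 0.
Proof. by rewrite -(scale0r 0) normvZ expr0n mul0r. Qed.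

Lemma directionsP P a w : w \in directions P a ->
  exists b r, [/\ b \in P, normv (b - a) != 0, r != 0 & w = r *: (b - a)].
Proof.
case/imsetP => _ /imsetP[b + ->] ->; rewrite inE => /andP[Pb ba_neq0].
have [|r r_neq0 ->] := @dirnP (b - a); last by exists b, r.
by apply: contraNneq ba_neq0 => ->; rewrite normv0.
Qed.

Lemma normv_directions P a w : w \in directions P a -> normv w != 0.
Proof.
case/directionsP => b [r [_ ba_neq0 r_neq0 ->]].
by rewrite normvZ mulf_eq0 negb_or ba_neq0 expf_eq0 /= r_neq0.
Qed.

Lemma dirn_directions P a w : w \in directions P a -> dirn w = w.
Proof.
move=> Dw; have w_neq0 : w != 0.
  by apply: contraNneq (normv_directions Dw) => ->; rewrite normv0.
have /imsetP[_ /imsetP[b + ->] wE] := Dw; rewrite inE => /andP[Pb ba_neq0].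
have [|r r_neq0 rE] := @dirnP (b - a).
  by apply: contraNneq ba_neq0 => ->; rewrite normv0.
by rewrite {1}wE rE dirnZ.
Qed.

Lemma directions_indep P a :
  {in directions P a &, forall u v r, u = r *: v -> u = v}.
Proof.
move=> u v Du Dv r uE; rewrite -(dirn_directions Du) -(dirn_directions Dv) uE.
apply: dirnZ; apply: contraNneq (normv_directions Du) => r0.
by rewrite uE r0 scale0r normv0.
Qed.

(** * Averaging over all matrices *)

Lemma card_annihilators (m : nat) v : v != 0 ->
  (#|F| ^ m * #|[set A : 'M[F]_(d, m) | v *m A == 0%R]|)%N = (#|F| ^ (d * m))%N.
Proof.
move=> v_neq0; have [i vi] := row_neq0 v_neq0.
have := @card_fiber 'M[F]_(d, m) 'rV[F]_m (mulmx v) 0.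
rewrite !card_mx mul1n; apply; first exact: mulmxDr.
(* The matrix whose row i is w / v_i and whose other rows vanish sends v to w. *)
move=> w; exists ((v 0 i)^-1 *: (delta_mx i 0 *m w)).
have v_delta : v *m delta_mx i 0 = (v 0 i)%:M.
  apply/rowP => j; rewrite ord1 !mxE eqxx (bigD1 i) //= mxE !eqxx mulr1 big1 ?addr0 //.
  by move=> k neq_ki; rewrite mxE (negPf neq_ki) mulr0.
by rewrite -scalemxAr mulmxA v_delta mul_scalar_mx scalerA mulVf // scale1r.
Qed.

Lemma card_annihilators_cover (m : nat) (W : {set 'rV[F]_d}) : 0 \notin W ->
  (#|F| ^ m * #|[set A : 'M[F]_(d, m) | [exists w in W, w *m A == 0%R]]|
     <= #|W| * #|F| ^ (d * m))%N.
Proof.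
move=> W0; apply: (@leq_trans (#|F| ^ m *
    \sum_(w in W) #|[set A : 'M[F]_(d, m) | w *m A == 0%R]|)%N).
  rewrite leq_mul2l; apply/orP; right; rewrite -sum1dep_card big_mkcond /=.
  under [X in (_ <= X)%N]eq_bigr => w _ do rewrite -sum1dep_card big_mkcond.
  rewrite exchange_big /=; apply: leq_sum => A _; case: ifP => // /existsP[w /andP[Ww wA]].
  by rewrite (bigD1 w) //= wA.
rewrite big_distrr /= -sum_nat_const; apply: leq_sum => w Ww.
by rewrite card_annihilators //; apply: contraNneq W0 => <-.
Qed.

(* For each matrix A with m columns, at least |P| - q^m points of P share their
   image under A with another point of P; summing over all A, a given direction
   accounts for a proportion q^-m of the matrices. *)
Lemma sum_directions_ge (m : nat) P :
  (#|F| ^ m * #|P| <= #|F| ^ m * #|F| ^ m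
     + \sum_(a in P) #|[set b in P | normv (b - a)%R == 0%R]|
     + \sum_(a in P) #|directions P a|)%N.
Proof.
have F_gt0 : (0 < #|F|)%N by apply/card_gt0P; exists 0.
pose good (A : 'M[F]_(d, m)) a := [exists b in P, (b != a) && ((b - a) *m A == 0)].
(* A is injective on the points of P that are not good, so there are at most q^m of them. *)
have pigeonhole A : (#|P| <= #|F| ^ m + #|[set a in P | good A a]|)%N.
  have -> : #|P| = (#|[set a in P | ~~ good A a]| + #|[set a in P | good A a]|)%N.
    rewrite -(cardID [pred a | ~~ good A a] P) /=; congr (_ + _)%N.
      by apply: eq_card => a; rewrite !inE andbC.
    by apply: eq_card => a; rewrite !inE negbK andbC.
  rewrite leq_add2r -(card_in_imset (f := fun a => a *m A)).
    by apply: leq_trans (max_card _) _; rewrite card_mx mul1n.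
  move=> a b; rewrite !inE => /andP[Pa _] /andP[Pb /existsPn/(_ a)] + eqA.
  by rewrite Pa mulmxBl eqA subrr eqxx andbT /= negbK => /eqP.
have cover a : (#|F| ^ m * #|[set A | good A a]| <=
    (#|[set b in P | normv (b - a)%R == 0%R]| + #|directions P a|) * #|F| ^ (d * m))%N.
  (* Isotropic differences enter one by one, the others only through their direction, which A kills
     whenever it kills the difference. *)
  pose W := [set b - a | b in P & (b != a) && (normv (b - a) == 0)] :|: directions P a.
  have W0 : 0 \notin W.
    rewrite inE negb_or; apply/andP; split; last first.
      by apply/negP => /normv_directions; rewrite normv0 eqxx.
    apply/imsetP => -[b]; rewrite inE => /andP[_ /andP[neq_ba _]] /esym/eqP.
    by rewrite subr_eq0 (negPf neq_ba).
  apply: leq_trans (_ : _ <= #|W| * #|F| ^ (d * m))%N _.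
    apply: leq_trans (card_annihilators_cover m W0); rewrite leq_mul2l.
    apply/orP; right; apply: subset_leq_card; apply/subsetP => A; rewrite !inE.
    case/existsP => b /and3P[Pb neq_ba baA]; apply/existsP.
    have [ba0 | ba_neq0] := eqVneq (normv (b - a)) 0.
      exists (b - a); rewrite baA andbT inE; apply/orP; left.
      by apply: imset_f; rewrite inE /= Pb neq_ba ba0 eqxx.
    exists (dirn (b - a)); apply/andP; split.
      by rewrite inE; apply/orP; right; do 2![apply: imset_f]; rewrite inE /= Pb.
    have [|r _ ->] := @dirnP (b - a); first by rewrite subr_eq0.
    by rewrite -scalemxAl (eqP baA) scaler0.
  rewrite leq_mul2r; apply/orP; right; apply: leq_trans (leq_card_setU _ _) _.
  rewrite leq_add2r; apply: leq_trans (leq_imset_card _ _) _.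
  apply: subset_leq_card; apply/subsetP => b; rewrite !inE.
  by case/and3P => -> _ ->.
have K_gt0 : (0 < #|F| ^ (d * m))%N by rewrite expn_gt0 F_gt0.
(* Multiplying by the number of matrices turns the claim into a double count of pairs (A, a). *)
rewrite -(leq_pmul2r K_gt0) -addnA -big_split mulnDl.
apply: (@leq_trans (#|F| ^ m * \sum_(A : 'M[F]_(d, m)) (#|F| ^ m + #|[set a in P | good A a]|))%N).
  rewrite -mulnA leq_mul2l; apply/orP; right.
  rewrite mulnC -[X in (X * _)%N](card_mx F d m) -sum_nat_const.
  by apply: leq_sum => A _; exact: pigeonhole.
have sum_const : (\sum_(A : 'M[F]_(d, m)) #|F| ^ m = #|F| ^ (d * m) * #|F| ^ m)%N.
  by rewrite -(card_mx F d m) -sum_nat_const; apply: eq_bigl.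
rewrite [X in (X <= _)%N](_ : _ = #|F| ^ m * (\sum_(A : 'M[F]_(d, m)) #|F| ^ m
    + \sum_A #|[set a in P | good A a]|))%N; last by rewrite big_split.
rewrite sum_const mulnDr; apply: leq_add.
  by rewrite -mulnA leq_mul2l [(_ ^ m * _ ^ (d * m))%N]mulnC leqnn orbT.
have -> : (\sum_A #|[set a in P | good A a]| = \sum_(a in P) #|[set A | good A a]|)%N.
  under eq_bigr => A _ do rewrite -sum1dep_card big_mkcondr.
  rewrite exchange_big /=; apply: eq_bigr => a _.
  by rewrite -sum1dep_card [RHS]big_mkcond.
rewrite big_distrr big_distrl /=; apply: leq_sum => a _; exact: cover.
Qed.

End Directions.

(** * Rescaling to a common norm *)

Lemma card_sqr_eq (F : finFieldType) (s : F) :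
  (#|[set r : F | r ^+ 2 == s]| <= 2)%N.
Proof.
have [-> | [r]] := set_0Vmem [set r : F | r ^+ 2 == s]; first by rewrite cards0.
rewrite inE => /eqP <-.
have /subset_leq_card : [set t : F | t ^+ 2 == r ^+ 2] \subset [set r; - r].
  by apply/subsetP => t; rewrite !inE eqf_sqr.
by move/leq_trans; apply; rewrite cards2; case: (_ != _).
Qed.

Lemma leq_card_imset_fibers (T U : finType) (f : T -> U) (S : {set T}) (k : nat) :
  (forall y, #|[set x in S | f x == y]| <= k)%N -> (#|S| <= k * #|f @: S|)%N.
Proof.
move=> fib; rewrite -sum1_card (partition_big_imset f) /= mulnC -sum_nat_const.
by apply: leq_sum => y _; rewrite sum1dep_card.
Qed.

Section CommonNorm.
Variables (F : finFieldType) (d : nat) (D : {set 'rV[F]_d}).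
Hypotheses (D_norm : {in D, forall v, normv v != 0})
  (D_indep : {in D &, forall u v r, u = r *: v -> u = v}).

Let normalizable l := [set v in D | [exists r, r ^+ 2 * normv v == l]].

(* The q - 1 nonzero multiples of a vector have nonzero norms, each norm being
   attained at most twice; average over the norm. *)
Lemma exists_common_norm :
  exists2 l : F, l != 0 & (#|D| <= 2 * #|normalizable l|)%N.
Proof.
apply/exists_inP; apply: contraT => /exists_inPn none.
have : (\sum_(l : F | l != 0%R) 2 * #|normalizable l| < \sum_(l : F | l != 0%R) #|D|)%N.
  rewrite (bigD1 1) ?oner_neq0 //= [ltnRHS](bigD1 1) ?oner_neq0 //=.
  rewrite -addSn leq_add //; first by rewrite ltnNge; apply: none; exact: oner_neq0.
  by apply: leq_sum => l /andP[l_neq0 _]; rewrite ltnW // ltnNge none.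
rewrite ltnNge => /negP[].
have -> : (\sum_(l : F | l != 0%R) #|D| = \sum_(v in D) \sum_(l : F | l != 0%R)
    #|[set r : F | (r != 0%R) && ((r ^+ 2 * normv v)%R == l)]|)%N.
  (* There are as many nonzero l as nonzero scalars r, so the sum is reread as a count of pairs (v,
     r), sorted by the norm of r v. *)
  rewrite sum_nat_const mulnC -sum_nat_const; apply: eq_bigr => v Dv.
  rewrite -sum1_card (partition_big (fun r => r ^+ 2 * normv v) (fun l => l != 0%R)) /=.
    by apply: eq_bigr => l _; rewrite -sum1dep_card.
  by move=> r r_neq0; rewrite mulf_neq0 ?D_norm // expf_neq0.
rewrite exchange_big /=; apply: leq_sum => l _.
rewrite (bigID (mem (normalizable l))) /= [X in (_ + X)%N]big1 => [|v]; last first.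
  case/andP=> Dv; rewrite inE Dv /= => /existsPn rP.
  by apply: eq_card0 => r; rewrite inE (negPf (rP r)) andbF.
rewrite addn0 mulnC -sum_nat_const big_mkcondl /= big_mkcond [leqRHS]big_mkcond /=.
apply: leq_sum => v _; case: ifP => // nv; case: ifP => // Dv.
apply: leq_trans (card_sqr_eq (l / normv v)); apply: subset_leq_card.
apply/subsetP => r; rewrite !inE => /andP[_ /eqP <-].
by rewrite mulfK // D_norm.
Qed.

Lemma common_norm_rescaling :
  exists l : F, exists E : {set 'rV[F]_d},
    [/\ l != 0, (#|D| <= 2 * #|E|)%N,
        {in E, forall u, normv u = l},
        {in E &, forall u v r, u = r *: v -> u = v} &
        {in E, forall u, exists v r, [/\ v \in D, r != 0 & u = r *: v]}].
Proof.
have [l l_neq0 cardD] := exists_common_norm.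
(* The default 0 is never reached on [normalizable l], and l != 0 forces the chosen scalar to be
   nonzero. *)
pose g (v : 'rV[F]_d) := odflt 0 [pick r | r ^+ 2 * normv v == l] *: v.
have gP v : v \in normalizable l ->
    exists r, [/\ v \in D, r != 0, g v = r *: v & normv (g v) = l].
  rewrite inE => /andP[Dv /existsP[r0 r0P]]; rewrite /g.
  case: pickP => [r /eqP rl /= | /(_ r0)]; last by rewrite r0P.
  exists r; split; rewrite ?normvZ //.
  by apply: contraNneq l_neq0 => r0'; rewrite -rl r0' expr0n mul0r.
have g_indep v w r : v \in normalizable l -> w \in normalizable l ->
    g v = r *: g w -> v = w.
  move=> /gP[s [Dv s_neq0 -> _]] /gP[s' [Dw _ -> _]] vw.
  apply: (D_indep Dv Dw (r := s^-1 * (r * s'))).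
  by rewrite -scalerA -[in RHS]scalerA -vw scalerA mulVf // scale1r.
exists l, (g @: normalizable l); split=> //.
- rewrite card_in_imset // => v w nv nw gvw.
  by apply: (g_indep _ _ 1) => //; rewrite scale1r.
- by move=> _ /imsetP[v /gP[r [_ _ _ ?]] ->].
- move=> _ _ /imsetP[v nv ->] /imsetP[w nw ->] r vw.
  by rewrite (g_indep _ _ _ nv nw vw).
- by move=> _ /imsetP[v /gP[r [Dv r_neq0 -> _]] ->]; exists v, r.
Qed.

End CommonNorm.

(** * From dot products to spreads *)

Lemma card_dotv_values (F : finFieldType) (d m : nat) (E : {set 'rV[F]_d}) :
  (1 < d)%N -> d.+1 = (2 * m)%N -> 0 \notin E ->
  {in E &, forall u v r, u = r *: v -> u = v} ->
  (#|F| * #|E| <= #|[set dotv u v | u in E, v in E]| * (#|E| + #|F| ^ m))%N.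
Proof.
move=> d_gt1 dm E0 E_indep; set T := [set dotv u v | u in E, v in E].
have [-> | E_neq0] := posnP #|E|; first by rewrite muln0.
pose N t := (\sum_(u in E) #|[set v in E | dotv u v == t]|)%N.
(* Since d + 1 = 2m, the second-moment bound is the square of |E| q^m. Summing over t in T then
   accounts for all |E|^2 pairs. *)
have N_le t : (#|F| * N t <= #|E| * (#|E| + #|F| ^ m))%N.
  have := @dotv_pairs rat F d E t d_gt1 E0 E_indep.
  have -> : (#|E| * #|E| * #|F| ^ d.+1 = (#|E| * #|F| ^ m) ^ 2)%N.
    by rewrite dm [(2 * m)%N]mulnC expnM; ring.
  have y_ge0 : 0 <= (#|E| * #|F| ^ m)%:R :> rat by rewrite ler0n.
  rewrite -/(N t) natrX => xy.
  rewrite -(ler_nat rat) mulnDr natrD natrM -lerBlDl.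
  rewrite leNgt; apply/negP => lt_yx.
  by move: xy; apply/negP; rewrite -ltNge ltr_pXn2r // nnegrE // (le_trans y_ge0 (ltW lt_yx)).
rewrite -(leq_pmul2l E_neq0).
have -> : (#|E| * (#|F| * #|E|) = \sum_(t in T) #|F| * N t)%N.
  rewrite -big_distrr /= mulnCA; congr (_ * _)%N.
  rewrite /N exchange_big /= -sum_nat_const; apply: eq_bigr => u Eu.
  rewrite -sum1_card (partition_big (dotv u) [in T]) /= => [|v Ev].
    by apply: eq_bigr => t _; rewrite -sum1dep_card.
  by apply: imset2_f.
by rewrite mulnCA -sum_nat_const; apply: leq_sum => t _.
Qed.

Lemma card_spreads_ge (F : finFieldType) (d m : nat) (P : {set 'rV[F]_d}) a :
  (1 < d)%N -> d.+1 = (2 * m)%N -> a \in P ->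
  (#|F| * #|directions P a| <=
     2 * #|spreads P| * (#|directions P a| + 2 * #|F| ^ m))%N.
Proof.
move=> d_gt1 dm Pa; set D := directions P a.
have [l [E [l_neq0 DE E_norm E_indep E_dir]]] :=
  common_norm_rescaling (@normv_directions _ _ P a) (@directions_indep _ _ P a).
have E0 : 0 \notin E.
  by apply/negP => /E_norm; rewrite normv0 => /esym/eqP; rewrite (negPf l_neq0).
have := card_dotv_values d_gt1 dm E0 E_indep.
set T := [set dotv u v | u in E, v in E] => TE.
pose f (t : F) := 1 - t ^+ 2 / l ^+ 2.
have f_spreads : f @: T \subset spreads P.
  apply/subsetP => _ /imsetP[_ /imset2P[u v Eu Ev ->] ->]; rewrite inE.
  have [_ [r1 [/directionsP[b [s1 [Pb nb s1_neq0 ->]]] r1_neq0 uE]]] := E_dir u Eu.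
  have [_ [r2 [/directionsP[c [s2 [Pc nc s2_neq0 ->]]] r2_neq0 vE]]] := E_dir v Ev.
  apply/existsP; exists a; rewrite Pa; apply/existsP; exists b; rewrite Pb.
  apply/existsP; exists c; rewrite Pc /spread_defined nb nc /=; apply/eqP.
  rewrite /f /spread; congr (1 - _).
  have -> : l ^+ 2 = normv u * normv v by rewrite !E_norm // expr2.
  rewrite uE vE !normvZ !(dotvZl, dotvZr); field.
  by rewrite nb nc s1_neq0 s2_neq0 r1_neq0 r2_neq0.
have T_le : (#|T| <= 2 * #|spreads P|)%N.
  apply: leq_trans (_ : _ <= 2 * #|f @: T|)%N _; last first.
    by rewrite leq_mul2l subset_leq_card.
  apply: leq_card_imset_fibers => y.
  apply: leq_trans (card_sqr_eq ((1 - y) * l ^+ 2)); apply: subset_leq_card.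
  apply/subsetP => t; rewrite !inE => /andP[_ /eqP <-].
  by rewrite /f opprB addrCA subrr addr0 divfK // expf_neq0.
apply: leq_trans (_ : _ <= #|T| * (#|D| + 2 * #|F| ^ m))%N _; last first.
  by rewrite leq_mul2r T_le orbT.
have T_le_F : (#|T| <= #|F|)%N by exact: max_card.
(* In the form (q - |T|) |E| <= |T| q^m the bound passes to D by |D| <= 2 |E|. *)
rewrite mulnDr -leq_subLR -mulnBl in TE.
rewrite mulnDr -leq_subLR -mulnBl [(#|T| * (2 * _))%N]mulnCA.
apply: leq_trans (_ : _ <= (#|F| - #|T|) * (2 * #|E|))%N _.
  by rewrite leq_mul2l DE orbT.
by rewrite mulnCA leq_mul2l TE orbT.
Qed.

(** * Many spreads *)

Lemma spreadsS (F : finFieldType) (d : nat) (P Q : {set 'rV[F]_d}) :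
  P \subset Q -> spreads P \subset spreads Q.
Proof.
move/subsetP=> PQ; apply/subsetP => s; rewrite !inE.
case/existsP=> a /andP[/PQ Qa /existsP[b /andP[/PQ Qb /existsP[c /andP[/PQ Qc sE]]]]].
apply/existsP; exists a; rewrite Qa; apply/existsP; exists b; rewrite Qb.
by apply/existsP; exists c; rewrite Qc.
Qed.

Lemma odd_card_ge3 (F : finFieldType) : odd #|F| -> (3 <= #|F|)%N.
Proof. by have := card_finNzRing_gt1 F; case: #|F| => [|[|[]]]. Qed.

(** Settles bounded q, where a single spread suffices. If even the spreads S(b, a, b) were all
    undefined, every pair of P would be isotropic, against [isotropic_pairs]. *)
Lemma spreads_gt0 (F : finFieldType) (d m : nat) (P : {set 'rV[F]_d}) :
  odd #|F| -> d.+1 = (2 * m)%N -> (0 < d)%N -> (#|F| ^ m < #|P|)%N ->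
  (0 < #|spreads P|)%N.
Proof.
move=> F_odd dm d_gt0 P_large; rewrite lt0n; apply/negP => /eqP/cards0_eq no_spread.
have isotropic a : a \in P -> [set b in P | normv (b - a) == 0] = P.
  move=> Pa; apply/setP => b; rewrite inE; case Pb: (b \in P) => //=.
  apply: contraT => nba; have := in_set0 (spread b a b); rewrite -no_spread inE.
  move=> /negbT/negP[]; apply/existsP; exists a; rewrite Pa; apply/existsP; exists b; rewrite Pb.
  by apply/existsP; exists b; rewrite Pb /spread_defined nba eqxx.
have := @isotropic_pairs rat F d P d_gt0 F_odd.
have -> : (\sum_(a in P) #|[set b in P | normv (b - a)%R == 0%R]| = #|P| * #|P|)%N.
  by rewrite -sum_nat_const; apply: eq_bigr => a Pa; rewrite isotropic.
have -> : (#|F| ^ d.+2 = #|F| * (#|F| ^ m * #|F| ^ m))%N.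
  by rewrite expnS dm [(2 * m)%N]mulnC expnM mulnn.
rewrite leNgt => /negP[].
have q_ge3 : 3 <= #|F|%:R :> rat by rewrite (ler_nat _ 3) odd_card_ge3.
have : (#|F| ^ m)%:R < #|P|%:R :> rat by rewrite ltr_nat.
have : 0 <= (#|F| ^ m)%:R :> rat by rewrite ler0n.
rewrite !natrM; move: (_ ^ m)%:R #|P|%:R #|F|%:R q_ge3 => N p q q_ge3 N_ge0 lt_Np.
have p_gt0 : 0 < p by exact: le_lt_trans lt_Np.
have -> : (q * (p * p) - p * p) ^+ 2 = (p * p) * ((q - 1) ^+ 2 * p ^+ 2) by ring.
rewrite ltr_pM2l ?mulr_gt0 //.
have lt_sqr : N * N < p ^+ 2 by rewrite -expr2 ltr_pXn2r ?nnegrE // ltW.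
(* With N < p this makes p^2 (q - 1)^2 exceed q N^2; here q >= 3 enters. *)
have : q <= (q - 1) ^+ 2 by nra.
by nra.
Qed.

(** Here N = q^m, p = |P|, x counts isotropic pairs and s sums the numbers of directions. Of the
    total N p, the term N^2 takes at most (1 - delta) N p and x at most (delta/2) N p. *)
Lemma sum_directions_arith (R : realFieldType) (eps delta q N p x s : R) :
  0 < eps -> delta = eps / (1 + eps) -> 0 < q -> 0 < N -> 0 < p ->
  16 <= delta ^+ 2 * q -> 4 * (2 + eps) <= delta * q ->
  (1 + eps) * N <= p -> p <= (2 + eps) * N ->
  N * p <= N * N + x + s ->
  (q * x - p * p) ^+ 2 <= p * p * (q * (N * N)) ->
  delta / 2 * N * p <= s.
Proof.
move=> eps_gt0 deltaE q_gt0 N_gt0 p_gt0 q_ge1 q_ge2 P_ge P_le directions_ge X_dev.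
have delta_gt0 : 0 < delta by rewrite deltaE divr_gt0 // addr_gt0.
have eps1_gt0 : 0 < 1 + eps by rewrite addr_gt0.
have epsE : delta * (1 + eps) = eps by rewrite deltaE divfK // gt_eqF.
(* The deviation is at most p N sqrt(q), and delta^2 q >= 16 makes sqrt(q) <= q delta / 4. *)
have X_le : q * x - p * p <= p * N * q * (delta / 4).
  have rhs_ge0 : 0 <= p * N * q * (delta / 4) by rewrite !mulr_ge0 ?invr_ge0 //; exact: ltW.
  rewrite leNgt; apply/negP => lt_X.
  have : (p * N * q * (delta / 4)) ^+ 2 < (q * x - p * p) ^+ 2.
    by rewrite ltr_pXn2r // nnegrE // ltW // (le_lt_trans rhs_ge0).
  apply/negP; rewrite -leNgt; apply: le_trans X_dev _.
  have -> : (p * N * q * (delta / 4)) ^+ 2 =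
      (p * p * (q * (N * N))) * (delta ^+ 2 * q / 16) by field.
  rewrite ler_peMr //; first by rewrite !mulr_ge0 //; exact: ltW.
  by rewrite ler_pdivlMr ?mul1r.
have p_le : p * p <= p * N * q * (delta / 4).
  rewrite -!mulrA ler_pM2l //; apply: le_trans P_le _.
  have -> : N * (q * (delta * 4^-1)) = (delta * q / 4) * N by ring.
  by rewrite ler_pM2r // ler_pdivlMr // mulrC.
have x_le : x <= p * N * (delta / 2).
  rewrite -(ler_pM2l q_gt0).
  have -> : q * (p * N * (delta / 2)) =
    p * N * q * (delta / 4) + p * N * q * (delta / 4) by field.
  by rewrite -lerBlDl in p_le *; lra.
(* The choice of delta gives 1 - delta = 1 / (1 + eps). *)
have N_le : N <= (1 - delta) * p.
  have -> : N = (1 - delta) * ((1 + eps) * N).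
    have -> : (1 - delta) * ((1 + eps) * N) = (1 + eps - delta * (1 + eps)) * N by ring.
    by rewrite epsE; ring.
  apply: ler_wpM2l => //; rewrite subr_ge0 deltaE ler_pdivrMr // mul1r lerDr.
  exact: ler01.
have : N * N <= N * ((1 - delta) * p) by rewrite ler_pM2l.
by lra.
Qed.

(** Some apex reaches the average. The upper bound on |P| keeps the expected |P|^2 / q isotropic
    pairs small against q^m |P|. *)
Lemma exists_rich_apex (R : realFieldType) (F : finFieldType) (d m : nat)
    (P : {set 'rV[F]_d}) (eps delta : R) :
  odd #|F| -> d.+1 = (2 * m)%N -> (0 < d)%N ->
  0 < eps -> delta = eps / (1 + eps) ->
  16 <= delta ^+ 2 * #|F|%:R -> 4 * (2 + eps) <= delta * #|F|%:R ->
  (1 + eps) * #|F|%:R ^+ m <= #|P|%:R -> #|P|%:R <= (2 + eps) * #|F|%:R ^+ m ->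
  exists2 a, a \in P & delta / 2 * #|F|%:R ^+ m <= #|directions P a|%:R.
Proof.
move=> F_odd dm d_gt0 eps_gt0 deltaE q_ge1 q_ge2 P_ge P_le.
have q_gt0 : 0 < #|F|%:R :> R.
  by rewrite ltr0n; apply: leq_trans (odd_card_ge3 F_odd).
have N_gt0 : 0 < #|F|%:R ^+ m :> R by rewrite exprn_gt0.
have p_gt0 : 0 < #|P|%:R :> R.
  by apply: lt_le_trans P_ge; rewrite mulr_gt0 // addr_gt0.
apply/exists_inP; apply: contraT => /exists_inPn poor.
have {poor} sumD : (\sum_(a in P) #|directions P a|)%:R <
    delta / 2 * #|F|%:R ^+ m * #|P|%:R :> R.
  rewrite mulr_natr -sumr_const natr_sum; apply: ltr_sum => [|a Pa].
    rewrite ltr0n card_gt0 in p_gt0.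
    by have [a Pa] := set0Pn _ p_gt0; apply/hasP; exists a; rewrite ?mem_index_enum.
  by rewrite ltNge poor.
have := sum_directions_ge m P; set X := (\sum_(a in P) #|[set _ in _ | _]|)%N.
rewrite -(ler_nat R) !natrD !natrM !natrX => directions_ge.
have X_dev : (#|F|%:R * X%:R - #|P|%:R * #|P|%:R) ^+ 2 <=
    #|P|%:R * #|P|%:R * (#|F|%:R * (#|F|%:R ^+ m * #|F|%:R ^+ m)) :> R.
  have := @isotropic_pairs R F d P d_gt0 F_odd; rewrite -/X.
  by rewrite expnS dm [(2 * m)%N]mulnC expnM -mulnn !natrM natrX.
have := sum_directions_arith eps_gt0 deltaE q_gt0 N_gt0 p_gt0 q_ge1 q_ge2 P_ge P_le
  directions_ge X_dev.
by rewrite leNgt sumD.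
Qed.

(** Take a minimal subset of size at least x: deleting one point brings it below x. *)
Lemma subset_with_card_le (R : realDomainType) (T : finType) (P : {set T}) (x : R) :
  0 < x -> x <= #|P|%:R ->
  exists2 Q : {set T}, Q \subset P & x <= #|Q|%:R <= x + 1.
Proof.
move=> x_gt0 x_le.
have [Q /minsetP[Q_ge Q_min] QP] :=
  @minset_exists _ (fun Q : {set T} => x <= #|Q|%:R) P x_le.
exists Q => //; apply/andP; split=> //.
have : (0 < #|Q|)%N by rewrite -(ltr0n R) (lt_le_trans x_gt0).
rewrite card_gt0 => /set0Pn[y Qy]; rewrite (cardsD1 y) Qy natrD addrC lerD2r leNgt.
apply/negP => /ltW lt_x; move: Qy.
by rewrite -(Q_min _ lt_x (subsetDl _ _)) !inE eqxx.
Qed.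

Lemma spread_count_arith (R : realFieldType) (delta q N D S : R) :
  0 < delta -> delta <= 1 -> 0 < N -> 0 <= S ->
  delta / 2 * N <= D -> q * D <= 2 * S * (D + 2 * N) -> delta * q <= 10 * S.
Proof.
move=> delta_gt0 delta_le1 N_gt0 S_ge0 D_ge qD.
have D_gt0 : 0 < D by apply: lt_le_trans D_ge; rewrite mulr_gt0 // divr_gt0.
(* From delta D <= D and 2 delta N <= 4 D; the 5 doubles to the final 10. *)
have DN : delta * (D + 2 * N) <= 5 * D.
  have : delta * D <= D by rewrite ler_piMl // ltW.
  by move: D_ge; lra.
rewrite -(ler_pM2r D_gt0); apply: le_trans (_ : _ <= 2 * S * (delta * (D + 2 * N))) _.
  by have := ler_wpM2l (ltW delta_gt0) qD; lra.
have : 2 * S * (delta * (D + 2 * N)) <= 2 * S * (5 * D) by rewrite ler_wpM2l ?mulr_ge0.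
by lra.
Qed.

Theorem theorem1p5 (R : realType) (d : nat) (d_ge3 : (3 <= d)%N) (d_odd : odd d)
    (eps : R) (eps_gt0 : 0 < eps) :
  exists c : R, 0 < c /\
    forall (F : finFieldType) (P : {set 'rV[F]_d}),
      odd #|F| ->
      (1 + eps) * #|F|%:R ^+ (d.+1)./2 <= #|P|%:R ->
      c * #|F|%:R <= #|spreads P|%:R.
Proof.
have [m mE] : exists m, m = (d.+1)./2 by exists (d.+1)./2.
have dm : d.+1 = (2 * m)%N by rewrite mE mul2n even_halfK //= d_odd.
rewrite -mE.
have [delta deltaE] : exists delta, delta = eps / (1 + eps) by exists (eps / (1 + eps)).
have eps1_gt0 : 0 < 1 + eps by rewrite addr_gt0.
have delta_gt0 : 0 < delta by rewrite deltaE divr_gt0.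
have delta_le1 : delta <= 1 by rewrite deltaE ler_pdivrMr // mul1r lerDr ler01.
(* The first two terms are the thresholds on q in [exists_rich_apex], the third is the loss in
   [spread_count_arith]. K separates small from large q, and c = 1/K. *)
have [K KE] : exists K, K = 16 / delta ^+ 2 + 4 * (2 + eps) / delta + 10 / delta.
  by exists (16 / delta ^+ 2 + 4 * (2 + eps) / delta + 10 / delta).
have K1_gt0 : 0 < 16 / delta ^+ 2 by rewrite divr_gt0 // exprn_gt0.
have K2_gt0 : 0 < 4 * (2 + eps) / delta by rewrite divr_gt0 // mulr_gt0 // addr_gt0.
have K3_gt0 : 0 < 10 / delta by rewrite divr_gt0.
have K_gt0 : 0 < K by rewrite KE !addr_gt0.
exists K^-1; split=> [|F P F_odd P_ge]; first by rewrite invr_gt0.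
rewrite mulrC ler_pdivrMr //.
have q_ge3 := odd_card_ge3 F_odd.
have q_gt0 : 0 < #|F|%:R :> R by rewrite ltr0n; apply: leq_trans q_ge3.
have N_ge1 : 1 <= #|F|%:R ^+ m :> R by rewrite exprn_ege1 // ler1n (leq_trans _ q_ge3).
have N_gt0 : 0 < #|F|%:R ^+ m :> R by rewrite exprn_gt0.
(* For q <= K the claim c q <= 1 only asks for one spread. *)
have [q_le | K_lt] := leP #|F|%:R K.
  apply: le_trans q_le _; apply: ler_peMl; first exact: ltW.
  rewrite ler1n.
  apply: (@spreads_gt0 F d m) => //; first by apply: leq_trans d_ge3.
  rewrite -(ltr_nat R) natrX (lt_le_trans _ P_ge) //.
  by rewrite ltr_pMl // ltrDl.
have x_gt0 : 0 < (1 + eps) * #|F|%:R ^+ m by rewrite mulr_gt0.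
have [Q QP /andP[Q_ge Q_le]] := subset_with_card_le x_gt0 P_ge.
have [||||a Qa a_rich] := exists_rich_apex F_odd dm _ eps_gt0 deltaE _ _ Q_ge.
- by apply: leq_trans d_ge3.
- by rewrite [leRHS]mulrC -ler_pdivrMr ?exprn_gt0 // ltW // (le_lt_trans _ K_lt) // KE; lra.
- by rewrite [leRHS]mulrC -ler_pdivrMr // ltW // (le_lt_trans _ K_lt) // KE; lra.
(* The extra point is absorbed by q^m >= 1, whence the factor 2 + eps. *)
- by apply: le_trans Q_le _; lra.
have := card_spreads_ge (leq_trans _ d_ge3) dm Qa => /(_ isT).
have sQP : #|spreads Q|%:R <= #|spreads P|%:R :> R.
  by rewrite ler_nat subset_leq_card // spreadsS.
rewrite -(ler_nat R) !natrM natrD natrM natrX => spreads_ge.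
have := spread_count_arith delta_gt0 delta_le1 N_gt0 (ler0n R _) a_rich spreads_ge.
rewrite mulrC -ler_pdivlMr // => q_le; apply: le_trans q_le _.
apply: le_trans (_ : _ <= #|spreads Q|%:R * (10 / delta)) _; first by lra.
by apply: ler_pM => //; rewrite ?KE; lra.
Qed.
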